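(* Let $K$ be a field and $T$ a subgroup of $K^\times$. Let $K_T$ be the factor hyperfield of $K$ by $T$, let $\mathcal X(K_T)$ be the set of all orderings of the hyperfield $K_T$, and let $\mathcal X(K\mid T)$ be the set of all orderings $P$ of $K$ with $T\subseteq P$. Then $$|\mathcal X(K_T)|=|\mathcal X(K\mid T)|.$$ In particular, $\mathcal X(K_T)\neq\emptyset$ if and only if $\mathcal X(K\mid T)\neq\emptyset$.
   Context: A hyperoperation $+$ on a nonempty set $H$ assigns to each $(x,y)\in H\times H$ a nonempty subset $x+y\subseteq H$; for subsets, $A+B=\bigcup_{a\in A,b\in B}(a+b)$. A canonical hypergroup is $(H,+,0)$ with $+$ an associative and commutative hyperoperation such that for every $x$ there is a unique $-x$ with $0\in x+(-x)$, and $z\in x+y$ implies $y\in z-x:=z+(-x)$. A hyperring is $(R,+,\cdot,0)$ with $(R,+,0)$ a canonical hypergroup, $(R,\cdot)$ a commutative semigroup with $x\cdot 0=0$, and $x(y+z)=xy+xz$ as sets. A hyperfield is a hyperring $F$ with unity $1\neq 0$ such that $F^\times=F\setminus\{0\}$ is a group under multiplication. Every field is a hyperfield in which $x+y$ is a singleton. Factor hyperfield: for a field $K$ and a subgroup $T\le K^\times$, $K_T=\{[x]_T: x\in K\}$ where $[x]_T=xT=\{xt: t\in T\}$, with $[x]_T+[y]_T=\{[xt+yu]_T: t,u\in T\}$ and $[x]_T\cdot[y]_T=[xy]_T$; this is a hyperfield with zero $[0]_T=\{0\}$ and $-[x]_T=[-x]_T$. An ordering of a hyperfield (in particular of a field)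 $F$ is a subset $P\subseteq F$ with $P+P\subseteq P$, $P\cdot P\subseteq P$, $P\cap -P=\emptyset$, $P\cup -P=F^\times$. $|X|$ denotes cardinality. *)

(* Defs.v *)
From mathcomp Require Import all_boot all_algebra.
From mathcomp Require Import mathcomp_extra boolp classical_sets functions cardinality.

Set Implicit Arguments.
Unset Strict Implicit.
Unset Printing Implicit Defensive.

Import GRing.Theory.

Local Open Scope ring_scope.
Local Open Scope classical_set_scope.

Definition hyperop (H : Type) := H -> H -> set H.

Definition hsetop (H : Type) (op : hyperop H) (A B : set H) : set H :=
  [set z | exists x y, [/\ A x, B y & op x y z]].

(* The inverse is carried as a function; opp_unique says that [opp x] is the
   one and only element y with 0 in x + y. *)
Record canonical_hypergroup_axioms (H : Type) (add : hyperop H) (zero : H)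
    (opp : H -> H) : Prop := CanonicalHypergroupAxioms {
  add_nonempty : forall x y, add x y !=set0;
  add_assoc : forall x y z,
    hsetop add (add x y) [set z] = hsetop add [set x] (add y z);
  add_comm : forall x y, add x y = add y x;
  opp_unique : forall x y, add x y zero <-> y = opp x;
  add_reversible : forall x y z, add x y z -> add z (opp x) y }.

Record hyperring_axioms (R : Type) (add : hyperop R) (mul : R -> R -> R)
    (zero : R) (opp : R -> R) : Prop := HyperringAxioms {
  hyperring_add : canonical_hypergroup_axioms add zero opp;
  mul_assoc : forall x y z, mul x (mul y z) = mul (mul x y) z;
  mul_comm : forall x y, mul x y = mul y x;
  mul_zero : forall x, mul x zero = zero;
  mul_add_distr : forall x y z,
    [set mul x w | w in add y z] = add (mul x y) (mul x z) }.

Record hyperfield_axioms (F : Type) (add : hyperop F) (mul : F -> F -> F)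
    (zero one : F) (opp : F -> F) : Prop := HyperfieldAxioms {
  hyperfield_hyperring : hyperring_axioms add mul zero opp;
  one_neq_zero : one <> zero;
  mul_one : forall x, mul x one = x;
  mul_neq_zero : forall x y, x <> zero -> y <> zero -> mul x y <> zero;
  mul_inverse : forall x, x <> zero -> exists2 y, y <> zero & mul x y = one }.

Record hyperfield := Hyperfield {
  hcarrier :> Type;
  hadd : hyperop hcarrier;
  hmul : hcarrier -> hcarrier -> hcarrier;
  hzero : hcarrier;
  hone : hcarrier;
  hopp : hcarrier -> hcarrier;
  hyperfieldP : hyperfield_axioms hadd hmul hzero hone hopp }.

Record is_ordering (F : hyperfield) (P : set F) : Prop := IsOrdering {
  ordering_add : hsetop (@hadd F) P P `<=` P;
  ordering_mul : [set hmul x y | x in P & y in P] `<=` P;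
  ordering_disjoint : P `&` [set hopp x | x in P] = set0;
  ordering_cover : P `|` [set hopp x | x in P] = ~` [set hzero F] }.

Definition orderings (F : hyperfield) : set (set F) := [set P | is_ordering P].
Arguments orderings : clear implicits.

Lemma field_hyperfield_axioms (K : fieldType) :
  hyperfield_axioms (fun x y : K => [set x + y]) *%R 0 1 -%R.
Proof.
split.
- split.
  + split.
    * by move=> x y; exists (x + y).
    * move=> x y z; apply/seteqP; split=> w [a [b [/= -> -> ->]]].
        by exists x, (y + z); split=> //=; rewrite addrA.
      by exists (x + y), z; split=> //=; rewrite addrA.
    * by move=> x y; rewrite addrC.
    * move=> x y /=; split=> [/esym/eqP|->]; last by rewrite subrr.
      by rewrite addrC addr_eq0 => /eqP.
    * by move=> x y z /= ->; rewrite addrC addKr.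
  + exact: mulrA.
  + exact: mulrC.
  + exact: mulr0.
  + move=> x y z; apply/seteqP; split=> w /=; first by move=> [_ -> <-]; rewrite mulrDr.
    by move=> ->; exists (y + z) => //; rewrite mulrDr.
- by apply/eqP/oner_neq0.
- exact: mulr1.
- by move=> x y /eqP x0 /eqP y0; apply/eqP; rewrite mulf_neq0.
- move=> x /eqP x0; exists x^-1; last by rewrite divff.
  by apply/eqP; rewrite invr_eq0.
Qed.

Definition field_hyperfield (K : fieldType) : hyperfield :=
  Hyperfield (field_hyperfield_axioms K).

Record is_unit_subgroup (K : fieldType) (T : set K) : Prop := IsUnitSubgroup {
  subgroup_neq0 : forall x, T x -> x != 0;
  subgroup_one : T 1;
  subgroup_mul : forall x y, T x -> T y -> T (x * y);
  subgroup_inv : forall x, T x -> T x^-1 }.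

Definition tcoset (K : fieldType) (T : set K) (x : K) : set K :=
  [set x * t | t in T].

Definition factor (K : fieldType) (T : set K) : Type :=
  set_type (range (tcoset T)).

Section Factor.
Variables (K : fieldType) (T : set K).
Implicit Types (x y z : K) (A B C : factor T).

Definition fclass x : factor T := SigSub (mem_set (imageT (tcoset T) x)).

Lemma fclass_surj A : exists x, A = fclass x.
Proof.
have [x _ xA] := set_mem (valP A).
by exists x; apply: val_inj; rewrite /= xA.
Qed.

Definition frepr A : K := projT1 (cid (fclass_surj A)).

Definition fadd A B : set (factor T) :=
  [set C | exists x y, [/\ A = fclass x, B = fclass y &
     exists t u, [/\ T t, T u & C = fclass (x * t + y * u)]]].

(* Given by representatives; fadd_class, fmul_class and fopp_class below show
   that no operation depends on them. *)
Definition fmul A B : factor T := fclass (frepr A * frepr B).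
Definition fopp A : factor T := fclass (- frepr A).

Lemma freprK A : fclass (frepr A) = A.
Proof. by rewrite /frepr; case: cid. Qed.

Hypothesis hT : is_unit_subgroup T.
Let T0 := subgroup_neq0 hT.
Let T1 := subgroup_one hT.
Let TM := subgroup_mul hT.
Let TV := subgroup_inv hT.

Lemma fclassE x y : fclass x = fclass y <-> exists2 t, T t & x = y * t.
Proof.
split=> [e|[t Tt ->]].
  have : val (fclass x) x by exists 1 => //; rewrite mulr1.
  by rewrite e => -[t Tt <-]; exists t.
apply: val_inj; apply/seteqP; split=> z [u Tu <-] /=.
  by exists (t * u); [exact: TM | rewrite mulrA].
exists (t^-1 * u); first by apply: TM => //; exact: TV.
by rewrite mulrA mulfK // T0.
Qed.

Lemma fclass_mulT x t : T t -> fclass (x * t) = fclass x.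
Proof. by move=> Tt; apply/fclassE; exists t. Qed.

Lemma fadd_class x y :
  fadd (fclass x) (fclass y) =
  [set fclass (x * t + y * u) | t in T & u in T].
Proof.
apply/seteqP; split=> C.
  move=> [x' [y' [/esym/fclassE[a Ta ->] /esym/fclassE[b Tb ->]]]].
  move=> [t [u [Tt Tu ->]]]; rewrite -!mulrA.
  by exists (a * t); [exact: TM | exists (b * u) => //; exact: TM].
by move=> [t Tt [u Tu <-]]; exists x, y; split=> //; exists t, u.
Qed.

Lemma fmul_class x y : fmul (fclass x) (fclass y) = fclass (x * y).
Proof.
rewrite /fmul; have /fclassE[t Tt ->] := freprK (fclass x).
have /fclassE[u Tu ->] := freprK (fclass y).
by apply/fclassE; exists (t * u); [exact: TM | rewrite mulrACA].
Qed.

Lemma fopp_class x : fopp (fclass x) = fclass (- x).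
Proof.
rewrite /fopp; have /fclassE[t Tt ->] := freprK (fclass x).
by apply/fclassE; exists t => //; rewrite mulNr.
Qed.

Lemma fclass_eq0 x : fclass x = fclass 0 <-> x = 0.
Proof.
split=> [|->//]; by move=> /fclassE[t _]; rewrite mul0r.
Qed.

Lemma faddP x y C : fadd (fclass x) (fclass y) C <->
  exists a b, [/\ fclass a = fclass x, fclass b = fclass y & C = fclass (a + b)].
Proof.
rewrite fadd_class; split.
  move=> [t Tt [u Tu <-]]; exists (x * t), (y * u).
  by rewrite !fclass_mulT.
by move=> [a [b [/fclassE[t Tt ->] /fclassE[u Tu ->] ->]]]; exists t => //; exists u.
Qed.

Lemma factor_hyperfield_axioms :
  hyperfield_axioms fadd fmul (fclass 0) (fclass 1) fopp.
Proof.
have addC A B : fadd A B `<=` fadd B A.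
  move=> C [x [y [eA eB [t [u [Tt Tu ->]]]]]].
  by exists y, x; split=> //; exists u, t; rewrite addrC.
have addCE A B : fadd A B = fadd B A by apply/seteqP; split; exact: addC.
have half A B C : hsetop fadd (fadd A B) [set C] `<=` hsetop fadd [set A] (fadd B C).
  have [x ->] := fclass_surj A; have [y ->] := fclass_surj B.
  have [z ->] := fclass_surj C.
  move=> D [E [_ [+ /= -> +]]]; rewrite fadd_class => -[t Tt [u Tu <-]].
  rewrite fadd_class => -[v Tv [w Tw <-]].
  exists (fclass x), (fclass (y * (u * v) + z * w)); split=> //.
    by rewrite fadd_class; exists (u * v); [exact: TM | exists w].
  rewrite fadd_class; exists (t * v); [exact: TM | exists 1 => //].
  by congr fclass; rewrite mulr1 mulrDl -!mulrA addrA.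
have swap (X Y : set (factor T)) : hsetop fadd X Y = hsetop fadd Y X.
  by apply/seteqP; split=> C [a [b [? ? ?]]]; exists b, a; split=> //; exact: addC.
split.
- split.
  + split.
    * move=> A B; exists (fclass (frepr A * 1 + frepr B * 1)).
      by exists (frepr A), (frepr B); rewrite !freprK; split=> //; exists 1, 1.
    * move=> A B C; apply/seteqP; split; first exact: half.
      rewrite swap (addCE B C) (addCE A B) [X in _ `<=` X]swap.
      exact: half.
    * exact: addCE.
    * move=> A B; have [x ->] := fclass_surj A; have [y ->] := fclass_surj B.
      rewrite fopp_class; split.
        rewrite fadd_class => -[t Tt [u Tu /fclass_eq0/eqP]].
        rewrite addrC addr_eq0 => /eqP yuE.
        by rewrite -(fclass_mulT y Tu) yuE -mulNr fclass_mulT.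
      move=> ->; apply/faddP; exists x, (- x); by rewrite subrr.
    * move=> A B C; have [x ->] := fclass_surj A; have [y ->] := fclass_surj B.
      move=> /faddP[a [b [<- <- ->]]]; rewrite fopp_class; apply/faddP.
      by exists (a + b), (- a); rewrite addrAC subrr add0r.
  + move=> A B C; have [x ->] := fclass_surj A; have [y ->] := fclass_surj B.
    by have [z ->] := fclass_surj C; rewrite !fmul_class mulrA.
  + by move=> A B; rewrite /fmul mulrC.
  + by move=> A; have [x ->] := fclass_surj A; rewrite fmul_class mulr0.
  + move=> A B C; have [x ->] := fclass_surj A; have [y ->] := fclass_surj B.
    have [z ->] := fclass_surj C; rewrite !fmul_class !fadd_class.
    apply/seteqP; split=> D.
      move=> [_ [t Tt [u Tu <-]] <-]; exists t => //; exists u => //.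
      by rewrite fmul_class mulrDr !mulrA.
    move=> [t Tt [u Tu <-]]; exists (fclass (y * t + z * u)).
      by exists t => //; exists u.
    by rewrite fmul_class mulrDr !mulrA.
- by move=> /fclass_eq0/eqP; rewrite oner_eq0.
- by move=> A; have [x ->] := fclass_surj A; rewrite fmul_class mulr1.
- move=> A B; have [x ->] := fclass_surj A; have [y ->] := fclass_surj B.
  rewrite fmul_class => x0 y0 /fclass_eq0/eqP; rewrite mulf_eq0.
  by move=> /orP[]/eqP/fclass_eq0.
- move=> A; have [x ->] := fclass_surj A => x0.
  have {}x0 : x != 0 by apply/eqP => /fclass_eq0.
  exists (fclass x^-1); last by rewrite fmul_class divff.
  by move=> /fclass_eq0/eqP; rewrite invr_eq0 (negbTE x0).
Qed.

Definition factor_hyperfield : hyperfield := Hyperfield factor_hyperfield_axioms.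

End Factor.

Definition orderings_over (K : fieldType) (T : set K) : set (set K) :=
  [set P | orderings (field_hyperfield K) P /\ T `<=` P].

(* Main.v *)
Require Import Defs.
From mathcomp Require Import all_boot all_algebra.
From mathcomp Require Import mathcomp_extra boolp classical_sets functions cardinality.

(** Let [pi : K -> K_T] send [x] to its class [x]_T; the bijection is
    [Q |-> pi^-1(Q)].  The subsets of [K_T] correspond through [pi^-1] to the
    [T]-stable subsets of [K], because [pi] is onto and its fibres are the
    cosets of [T].  Under this correspondence each ordering axiom for [Q] is the
    same axiom for [pi^-1(Q)]: multiplication, opposite and zero pass to the
    quotient, and the elements [x t + y u] making up [x]_T + [y]_T are ordinary
    sums of elements of a [T]-stable set as soon as [x] and [y] lie in it
    ([is_ordering_preimage]).

    It remains to see that the orderings of [K] which are [T]-stable are exactly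
    those containing [T].  One containing [T] is stable since it is closed under
    products ([preimage_image_ordering]); conversely every ordering contains 1
    ([ordering_one]), so a stable one contains [1 * T = T]. *)

Import GRing.Theory.

Local Open Scope ring_scope.
Local Open Scope classical_set_scope.
Local Open Scope card_scope.

Lemma hoppK (F : hyperfield) : involutive (@hopp F).
Proof.
have A := hyperring_add (hyperfield_hyperring (hyperfieldP F)) => x.
by apply/esym/(opp_unique A); rewrite (add_comm A); apply/(opp_unique A).
Qed.

(** Since the opposite is an involution, membership in [-P] is membership of
    the opposite in [P], which makes every ordering axiom pointwise and hence
    easy to pull back along a map. *)
Lemma is_orderingP (F : hyperfield) (P : set F) :
  is_ordering P <->
  [/\ forall x y z, P x -> P y -> hadd x y z -> P z,
      forall x y, P x -> P y -> P (hmul x y),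
      forall x, P x -> ~ P (hopp x) &
      forall x, P x \/ P (hopp x) <-> x <> hzero F].
Proof.
have oppE : [set hopp x | x in P] = [set x | P (hopp x)].
  apply/seteqP; split=> [_ [y Py <-]|x Px] /=; first by rewrite hoppK.
  by exists (hopp x); rewrite ?hoppK.
split=> [[PD PM PI PU]|[PD PM PI PU]].
- split.
  + by move=> x y z Px Py xyz; apply: PD; exists x, y.
  + by move=> x y Px Py; apply: PM; exists x => //; exists y.
  + move=> x Px PNx; suff : (set0 : set F) x by [].
    by rewrite -PI oppE.
  + by move=> x; have := congr1 (@^~ x) PU; rewrite oppE /setU /= => ->.
- split.
  + by move=> z [x [y [Px Py xyz]]]; exact: PD xyz.
  + by move=> _ [x Px [y Py <-]]; exact: PM.
  + by rewrite oppE; apply/seteqP; split=> x // [Px /(PI _ Px)].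
  + by rewrite oppE; apply/seteqP; split=> x /PU.
Qed.

(** One of 1 and -1 lies in the ordering, and 1 is the square of both. *)
Lemma ordering_one (K : fieldType) (P : set (field_hyperfield K)) :
  is_ordering P -> P (1 : K).
Proof.
move=> /is_orderingP[_ PM _ PU].
have /PU[//|PN1] : (1 : K) <> 0 by apply/eqP/oner_neq0.
by have /= := PM _ _ PN1 PN1; rewrite mulrNN mulr1.
Qed.

Section FactorOrderings.
Variables (K : fieldType) (T : set K).
Hypothesis hT : is_unit_subgroup T.
Local Notation pi := (@fclass K T).

(** The sums [x * t + y * u] reduce to plain sums because [pi] absorbs [t] and
    [u]; [T] is contained in the preimage because [pi] sends all of it to the
    class of 1. *)
Lemma is_ordering_preimage (Q : set (factor_hyperfield hT)) :
  is_ordering Q <-> orderings_over T (pi @^-1` Q).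
Proof.
split=> [/is_orderingP[/= QD QM QI QU]|].
- have ordP : orderings (field_hyperfield K) (pi @^-1` Q).
    apply/is_orderingP; split=> /=.
    + move=> x y _ Qx Qy ->; apply: QD Qx Qy _.
      by apply/(faddP hT); exists x, y.
    + by move=> x y Qx Qy; rewrite -(fmul_class hT); exact: QM.
    + by move=> x /QI; rewrite (fopp_class hT).
    + move=> x; rewrite -(fopp_class hT); apply: (iff_trans (QU _)).
      by split=> xN0 x0; apply: xN0; apply/(fclass_eq0 hT).
  split=> // t Tt; rewrite /preimage /= -[t]mul1r (fclass_mulT hT) //.
  exact: (ordering_one _ _ ordP).
- move=> [/is_orderingP[/= QD QM QI QU] _]; apply/is_orderingP; split=> /=.
  + move=> A B C; have [x ->] := fclass_surj A; have [y ->] := fclass_surj B.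
    move=> Qx Qy /(faddP hT)[a [b [ax yb ->]]].
    by apply: (QD a b) => //; rewrite ?ax ?yb.
  + move=> A B; have [x ->] := fclass_surj A; have [y ->] := fclass_surj B.
    by rewrite (fmul_class hT); exact: QM.
  + by move=> A; have [x ->] := fclass_surj A; rewrite (fopp_class hT); exact: QI.
  + move=> A; have [x ->] := fclass_surj A; rewrite (fopp_class hT).
    apply: (iff_trans (QU x)).
    by split=> xN0 x0; apply: xN0; apply/(fclass_eq0 hT).
Qed.

(** Closure under products makes an ordering containing [T] a union of cosets
    of [T], that is, saturated for [pi]. *)
Lemma preimage_image_ordering (P : set K) :
  orderings_over T P -> pi @^-1` (pi @` P) = P.
Proof.
move=> [/is_orderingP[_ PM _ _] TP]; apply/seteqP; split; last first.
  exact: preimage_image.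
by move=> x [y Py /esym/(fclassE hT)[t Tt ->]]; apply: PM => //; exact: TP.
Qed.

Lemma preimage_orderings_bij :
  set_bij (orderings (factor_hyperfield hT)) (orderings_over T)
    (fun Q => pi @^-1` Q).
Proof.
split.
- by move=> Q /is_ordering_preimage.
- move=> Q Q' _ _ QQ'; apply/funext => A; have [x ->] := fclass_surj A.
  exact: (congr1 (@^~ x) QQ').
- move=> P oP; exists (pi @` P); last exact: preimage_image_ordering.
  by apply/is_ordering_preimage; rewrite preimage_image_ordering.
Qed.

End FactorOrderings.

Theorem theorem3p4 (K : fieldType) (T : set K) (hT : is_unit_subgroup T) :
  orderings (factor_hyperfield hT) #= orderings_over T /\
  (orderings (factor_hyperfield hT) !=set0 <-> orderings_over T !=set0).
Proof.
have bij := preimage_orderings_bij _ _ hT.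
split; first by apply/card_set_bijP; exists (fun Q => fclass T @^-1` Q).
have [sub _ sur] := bij; split=> [[Q oQ]|[P /sur[Q oQ _]]]; last by exists Q.
by eexists; exact: sub oQ.
Qed.
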